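(* Let $R=\{(0,0),(0,1),(0,2),(1,0),(1,1),(1,2),(2,0),(2,1),(2,2),(3,3)\}$. Then $(123,R)\sim_d(132,R)$.
   Context: $S_n$ denotes the set of permutations of $[n]=\{1,\dots,n\}$, written $\pi=\pi_1\cdots\pi_n$. A mesh pattern of length $k$ is a pair $(\tau,R)$ with $\tau\in S_k$ and $R\subseteq\{0,1,\dots,k\}^2$ (the shaded boxes; box $(a,b)$ is the unit square $[a,a+1]\times[b,b+1]$ in the diagram of $\tau$). An occurrence of $(\tau,R)$ in $\pi\in S_n$ is a choice of indices $i_1<\dots<i_k$ such that $\pi_{i_1}\cdots\pi_{i_k}$ is order-isomorphic to $\tau$ and, with $i_0=0$, $i_{k+1}=n+1$, $v_1<\dots<v_k$ the values $\pi_{i_1},\dots,\pi_{i_k}$ sorted increasingly, $v_0=0$, $v_{k+1}=n+1$, for every $(a,b)\in R$ there is no index $m$ with $i_a<m<i_{a+1}$ and $v_b<\pi_m<v_{b+1}$. Mesh patterns $p,q$ are equidistributed, $p\sim_d q$, if for all $n,\ell\ge0$ the number of $\pi\in S_n$ with exactly $\ell$ occurrences of $p$ equals the number with exactly $\ell$ occurrences of $q$. *)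

(* Defs.v *)
From mathcomp Require Import all_boot all_fingroup.
Set Implicit Arguments.
Unset Strict Implicit.
Unset Printing Implicit Defensive.

(* Permutations of [n] are elements of 'S_n, i.e. permutations of the 0-based
   'I_n; positions and values are shifted by one wherever they are compared
   with the sentinels 0 and n+1. Box indices are not shifted. *)

Record mesh_pattern (k : nat) := MeshPattern {
  mp_perm : 'S_k;
  mp_shade : {set 'I_k.+1 * 'I_k.+1}
}.

Section Occurrences.
Variables (k n : nat) (p : mesh_pattern k) (pi : 'S_n).
Implicit Type f : {ffun 'I_k -> 'I_n}.

(* For s of size k: 0 at a = 0, the entries of s at 1 <= a <= k, and n+1 at
   a = k+1 (the default of nth). *)
Definition gridline (s : seq nat) (a : nat) : nat := nth n.+1 (0 :: s) a.

Definition occ_pos f : seq nat := [seq (f j).+1 | j <- enum 'I_k].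

Definition occ_val f : seq nat :=
  sort leq [seq (pi (f j)).+1 | j <- enum 'I_k].

Definition in_box f (a b : nat) (m : 'I_n) : bool :=
  (gridline (occ_pos f) a < m.+1 < gridline (occ_pos f) a.+1) &&
  (gridline (occ_val f) b < (pi m).+1 < gridline (occ_val f) b.+1).

(* f j is the (j+1)-st chosen index. *)
Definition occurrence f : bool :=
  [&& [forall i : 'I_k, forall j : 'I_k, (i < j) ==> (f i < f j)],
      [forall i : 'I_k, forall j : 'I_k,
         (pi (f i) < pi (f j)) == (mp_perm p i < mp_perm p j)]
    & [forall ab in mp_shade p, forall m : 'I_n, ~~ in_box f ab.1 ab.2 m]].

Definition nb_occ : nat := #|[set f : {ffun 'I_k -> 'I_n} | occurrence f]|.

End Occurrences.

Definition equidistributed (k1 k2 : nat)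
    (p : mesh_pattern k1) (q : mesh_pattern k2) : Prop :=
  forall n l : nat,
    #|[set pi : 'S_n | nb_occ p pi == l]| = #|[set pi : 'S_n | nb_occ q pi == l]|.

Definition perm123 : 'S_3 := 1%g.

(* 0-based: fixes 0 and swaps 1 and 2. *)
Definition perm132 : 'S_3 := tperm (inord 1) (inord 2).

Definition boxes (k : nat) (s : seq (nat * nat)) : {set 'I_k.+1 * 'I_k.+1} :=
  [set ab | (val ab.1, val ab.2) \in s].

(* Main.v *)
(* Indices i < j < k carry an occurrence of either pattern exactly when pi i is
   below both pi j and pi k, every other point to the left of k lies above both
   of these values, and every point to the right of k lies below one of them
   ("corner" below). This condition is symmetric in the values pi j and pi k;
   the occurrence is of 123 if pi j < pi k and of 132 otherwise. Since i and j
   are determined by k, exchanging the values at j and k is an involution on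
   permutations; it toggles the type of the occurrence ending at k and leaves
   the type of the occurrences ending at every other index unchanged. Applying
   these involutions for all k in turn exchanges the two statistics. *)
Require Import Defs.
From mathcomp Require Import all_boot all_fingroup.
From mathcomp Require Import zify.
Set Implicit Arguments.
Unset Strict Implicit.

(** * Corners and the effect of exchanging their two upper values *)

Section Corner.
Variable n : nat.
Implicit Types (pi : 'S_n) (i j k l m : 'I_n).

Definition corner pi i j k : bool :=
  [&& i < j < k, pi i < pi j, pi i < pi k,
      [forall m : 'I_n, [&& m < k, m != i & m != j] ==>
         (pi j < pi m) && (pi k < pi m)]
    & [forall m : 'I_n, (k < m) ==> (pi m < pi j) || (pi m < pi k)]].

Lemma cornerP pi i j k :
  reflect [/\ i < j < k, pi i < pi j, pi i < pi k,
              forall m, m < k -> m <> i -> m <> j -> pi j < pi m /\ pi k < pi m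
            & forall m, k < m -> pi m < pi j \/ pi m < pi k]
          (corner pi i j k).
Proof.
apply: (iffP and5P) => -[ijk lt_ij lt_ik below above]; split=> //.
- move=> m lt_mk /eqP mi /eqP mj; apply/andP.
  by move/forallP/(_ m)/implyP: below; apply; rewrite lt_mk mi.
- by move=> m lt_km; apply/orP; move/forallP/(_ m)/implyP: above; apply.
- apply/forallP=> m; apply/implyP=> /and3P[lt_mk /eqP mi /eqP mj].
  by apply/andP; apply: below.
- by apply/forallP=> m; apply/implyP=> lt_km; apply/orP; apply: above.
Qed.

(** Among the values left of [k], the smallest sits at [i] and the second smallest at [j]. *)
Lemma corner_uniq pi i j i' j' k :
  corner pi i j k -> corner pi i' j' k -> i = i' /\ j = j'.
Proof.
move=> /cornerP[ijk lt_ij lt_ik below _] /cornerP[ijk' lt_ij' lt_ik' below' _].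
have ii' : i = i'.
  apply/eqP/negP=> /negP/eqP ne_ii'.
  have [e|/eqP ne] := eqVneq i j'; last by case: (below' i) => //; lia.
  have [e'|/eqP ne] := eqVneq i' j; last first.
    by case: (below i') => [||//|]; [lia|exact/nesym|lia].
  by subst; lia.
subst i'; split=> //; apply/eqP/negP=> /negP/eqP ne_jj'.
have [|||] // := below j'; [lia|by move=> e; subst j'; lia|by move=> e; subst j'|].
have [|||] // := below' j; [lia|by move=> e; subst j; lia|].
lia.
Qed.

Lemma corner_neq pi i j k : corner pi i j k -> pi j != pi k :> nat.
Proof.
move=> /cornerP[ijk _ _ _ _]; rewrite (inj_eq val_inj) (inj_eq perm_inj).
by apply/eqP=> e; subst; lia.
Qed.

(** Products apply the left factor first, so [tperm j k * pi] exchanges the entries at positions [j]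
    and [k]. *)
Lemma corner_swap pi i j k :
  corner pi i j k -> corner (tperm j k * pi)%g i j k.
Proof.
move=> /cornerP[ijk lt_ij lt_ik below above].
have ti : tperm j k i = i by rewrite tpermD //; apply/eqP=> e; subst; lia.
apply/cornerP; split; rewrite ?permM ?tpermL ?tpermR ?ti // => m.
  move=> lt_mk mi mj; rewrite permM tpermD; [|by apply/eqP=> /esym..|].
    by case: (below m).
  by apply/eqP=> e; subst; lia.
move=> lt_km; rewrite permM tpermD; first by case: (above m) => //; auto.
  by apply/eqP=> e; subst; lia.
by apply/eqP=> e; subst; lia.
Qed.

Lemma tperm_ltn j k l m : j < l -> k < l -> (tperm j k m < l) = (m < l).
Proof. by move=> jl kl; case: tpermP => [->|->|//]; rewrite jl kl. Qed.

(* The earlier swap may move entries of the corner at l, so the corner follows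
   the values; in corner_swap_after it stays at the same positions. *)
Lemma corner_swap_before pi i j k i' j' l (t := tperm j k) :
  corner pi i j k -> corner pi i' j' l -> k < l ->
  corner (t * pi)%g (t i') (t j') l.
Proof.
move=> /cornerP[ijk lt_ij lt_ik below above].
move=> /cornerP[ijk' lt_ij' lt_ik' below' above'] lt_kl.
have tl : t l = l by rewrite tpermD //; apply/eqP=> e; subst; lia.
have tt m : t (t m) = m by rewrite /t tpermK.
apply/cornerP; split; rewrite ?permM ?tt ?tl //.
(* The values are carried along and the set of positions left of [l] is preserved; what needs a case
   analysis is the order of the two moved positions. *)
- have -> : t j' < l by rewrite tperm_ltn; lia.
  rewrite andbT {tt tl}/t.
  have [ij|/eqP ij] := eqVneq i' j.
    rewrite ij tpermL tpermD; [|by apply/eqP=> e; subst; lia|].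
      rewrite ltnNge; apply/negP=> j'k.
      have [e|/eqP ne] := eqVneq j' k.
        by have [|||] := below' i; [lia|by move=> e'; subst; lia..|subst; lia].
      have [|||] := below j'; [|by move=> e'; subst; lia..|].
        have ne' : nat_of_ord j' <> k by move/val_inj.
        lia.
      have [|||] := below' k; [lia|by move=> e'; subst; lia|by move=> e'; subst|].
      lia.
    apply/eqP=> e; subst k i'.
    by have [|||] := below' i; [lia|by move=> e'; subst; lia..|lia].
  have [ik|/eqP ik] := eqVneq i' k.
    by rewrite ik tpermR tpermD; [|by apply/eqP=> e; subst; lia..]; subst; lia.
  rewrite (tpermD (z := i')) ?(eq_sym _ i'); [|exact/eqP..].
  case: tpermP => [e|e|_ _]; [by subst; lia| |by lia].
  (* Here [j' = k] moves to [j]. An [i'] strictly between [j] and [k] would have its value above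
     [pi k], against [pi i' < pi j']. *)
  rewrite ltnNge; apply/negP=> ji'.
  have ne' : nat_of_ord i' <> j by move/val_inj.
  have [|||] := below i'; [by subst; lia|by move=> e'; subst; lia|by []|].
  by subst; lia.
- move=> m lt_ml mi mj; rewrite permM; apply: below'.
  + by rewrite tperm_ltn; lia.
  + by move=> e; apply: mi; rewrite -e tt.
  + by move=> e; apply: mj; rewrite -e tt.
- move=> m lt_lm; rewrite permM; apply: above'.
  rewrite /t tpermD //; apply/eqP=> e; subst; lia.
Qed.

(** If [l < j], the swap only rearranges points to the right of [l]. Otherwise the two corners share
    [i], and exactly one of [j'] and [l] equals [j]; the other one carries a value above both [pi j]
    and [pi k], so exchanging these alters no comparison. *)
Lemma corner_swap_after pi i j k i' j' l (t := tperm j k) :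
  corner pi i j k -> corner pi i' j' l -> l < k ->
  corner (t * pi)%g i' j' l
  /\ ((t * pi)%g j' < (t * pi)%g l) = (pi j' < pi l).
Proof.
move=> cor cor' lt_lk; have /cornerP[ijk lt_ij lt_ik below above] := cor.
have /cornerP[ijk' lt_ij' lt_ik' below' above'] := cor'.
have [ltn_lj|le_jl] := ltnP l j.
  have fix_t m : m <= l -> t m = m.
    by move=> le_ml; rewrite /t tpermD //; apply/eqP=> e; subst; lia.
  rewrite !permM !fix_t; [split=> //|lia..].
  apply/cornerP; split; rewrite ?permM ?fix_t //; try lia.
  - by move=> m lt_ml; rewrite permM fix_t; [apply: below'|lia].
  - move=> m lt_lm; rewrite permM; apply: above'; rewrite /t.
    by case: tpermP.
(* The least value left of [k] is at [i], and [i < j <= l], so it is also the least value left of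
   [l]. *)
have ii' : i' = i.
  apply/eqP/negP=> /negP/eqP ne; have [e|/eqP ne'] := eqVneq i' j; last first.
    have [||| lt_ji' lt_ki'] := below i'; [lia|by []..|].
    have [e|/eqP ne''] := eqVneq j l; first by subst; lia.
    have [e|/eqP nej'] := eqVneq j j'.
      by subst; lia.
    have [|||//] := below' j; [|exact/nesym|by []|lia].
    by have : nat_of_ord j <> l by [move/val_inj]; lia.
  subst i'; have [e|/eqP ne''] := eqVneq i j'; first by subst; lia.
  have [|||] := below' i; [lia|exact/nesym|by []|lia].
subst i'.
(* If [j = l], then [pi j'] exceeds both exchanged values: type 132 before and after. *)
have [ejl|/eqP ne] := eqVneq j l.
  subst l; have [||| lt_jj' lt_kj'] := below j'; [lia|by move=> e; subst; lia..|].
  have tm m : m < j -> t m = m.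
    by move=> lt_mj; rewrite /t tpermD //; apply/eqP=> e; subst; lia.
  split; last first.
    rewrite !permM tpermL tm; [|lia].
    by rewrite !ltnNge (ltnW lt_jj') (ltnW lt_kj').
  apply/cornerP; split; rewrite ?permM ?tpermL ?tm //; try lia.
    move=> m lt_mj mi mj'; rewrite permM tm //.
    by have [||//|] := below' m => //; have [|||] := below m => //; [lia|
      move=> e; subst; lia].
  move=> m lt_jm; left; rewrite permM.
  have [->|/eqP ne] := eqVneq m k; first by rewrite tpermR.
  rewrite tpermD; first by case: (above' m) => //; lia.
    by apply/eqP=> e; subst; lia.
  by apply/eqP=> e; apply: ne.
(* If [j < l < k], then [pi l] exceeds both exchanged values, which forces [j' = j]: type 123 before
   and after. *)
have lt_jl : j < l by have : nat_of_ord j <> l by [move/val_inj]; lia.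
have [||| lt_jl' lt_kl'] := below l; [lia|by move=> e; subst; lia|exact/nesym|].
have ejj' : j' = j.
  apply/eqP/negP=> /negP/eqP ne'.
  have [|||] := below' j => //; [by move=> e; subst; lia|exact/nesym|lia].
subst j'.
have tm m : m <> j -> m <> k -> t m = m.
  by move=> mj mk; rewrite /t tpermD //; apply/eqP=> e; [apply: mj|apply: mk].
have ti : t i = i by rewrite tm // => e; subst; lia.
have tl : t l = l by rewrite tm // => e; subst; lia.
split; last by rewrite !permM tpermL tl lt_jl' lt_kl'.
apply/cornerP; split; rewrite ?permM ?tpermL ?ti ?tl //.
  move=> m lt_ml mi mj; rewrite permM tm //; last by move=> e; subst; lia.
  by have [||//|_ lt_lm] := below' m => //; split=> //; apply: ltn_trans lt_lm.
move=> m lt_lm; right; rewrite permM.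
have [->|/eqP ne'] := eqVneq m k; first by rewrite tpermR.
by rewrite tm //; [case: (above' m) => //; lia|move=> e; subst; lia].
Qed.

(* b = true selects occurrences of 123, b = false those of 132. *)
Definition corner_at (b : bool) pi k : bool :=
  [exists ij : 'I_n * 'I_n,
     corner pi ij.1 ij.2 k && ((pi ij.2 < pi k) == b)].

Lemma corner_atP b pi k :
  reflect (exists i j, corner pi i j k /\ (pi j < pi k) = b)
          (corner_at b pi k).
Proof.
apply: (iffP existsP) => [[[i j] /andP[/= cor /eqP lt_b]]|[i [j [cor lt_b]]]].
  by exists i, j.
by exists (i, j); rewrite /= cor lt_b eqxx.
Qed.

(** * Swap involutions and the count of corners of each type *)

Definition swap_at k pi : 'S_n :=
  if [pick ij : 'I_n * 'I_n | corner pi ij.1 ij.2 k] is Some ij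
  then (tperm ij.2 k * pi)%g else pi.

Lemma swap_atE pi i j k : corner pi i j k -> swap_at k pi = (tperm j k * pi)%g.
Proof.
rewrite /swap_at => cor; case: pickP => [[i' j'] /= cor'|/(_ (i, j))].
  by have [_ ->] := corner_uniq cor cor'.
by rewrite /= cor.
Qed.

Variant swap_at_spec k pi : 'S_n -> Type :=
  | SwapAtCorner i j of corner pi i j k :
      swap_at_spec k pi (tperm j k * pi)%g
  | SwapAtId of (forall i j, ~~ corner pi i j k) : swap_at_spec k pi pi.

Lemma swap_atP k pi : swap_at_spec k pi (swap_at k pi).
Proof.
rewrite /swap_at; case: pickP => [[i j] cor|nocor]; first exact: SwapAtCorner cor.
by apply: SwapAtId => i j; have /= -> := nocor (i, j).
Qed.

Lemma swap_atK k : involutive (swap_at k).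
Proof.
move=> pi; case: (swap_atP k pi) => [i j cor|nocor]; last first.
  by case: swap_atP => // i j; rewrite (negPf (nocor i j)).
by rewrite (swap_atE (corner_swap cor)) mulgA tperm2 mul1g.
Qed.

Lemma corner_at_swap b k pi :
  corner_at b (swap_at k pi) k = corner_at (~~ b) pi k.
Proof.
(* One implication suffices: applied to [swap_at k pi], it gives the converse by involutivity. *)
have imp b' pi' : corner_at b' pi' k -> corner_at (~~ b') (swap_at k pi') k.
  move=> /corner_atP[i [j [cor lt_b]]]; apply/corner_atP; exists i, j.
  rewrite (swap_atE cor); split; first exact: corner_swap.
  by rewrite !permM tpermL tpermR -lt_b -leqNgt ltn_neqAle eq_sym (corner_neq cor).
by apply/idP/idP => /imp; rewrite ?swap_atK ?negbK.
Qed.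

Lemma corner_at_swap_neq b k l pi :
  l != k -> corner_at b (swap_at k pi) l = corner_at b pi l.
Proof.
move=> ne_lk.
have imp pi' : corner_at b pi' l -> corner_at b (swap_at k pi') l.
  case: (swap_atP k pi') => // i j cor /corner_atP[i' [j' [cor' lt_b]]].
  apply/corner_atP; have [lt_lk|lt_kl|/val_inj e] := ltngtP l k.
  - by have [? ?] := corner_swap_after cor cor' lt_lk; exists i', j'; rewrite -lt_b.
  - exists (tperm j k i'), (tperm j k j'); split.
      exact: corner_swap_before cor cor' lt_kl.
    have /cornerP[ijk _ _ _ _] := cor.
    by rewrite !permM tpermK tpermD //; apply/eqP=> e; subst; lia.
  - by rewrite e eqxx in ne_lk.
by apply/idP/idP => /imp //; rewrite swap_atK.
Qed.

(** Only the swap at [l] toggles the type at [l], and [uniq r] lets it happen at most once. *)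
Lemma corner_at_foldr b r l pi :
  uniq r -> corner_at b (foldr swap_at pi r) l = corner_at (b (+) (l \in r)) pi l.
Proof.
elim: r b => [|k r IHr] b /=; first by rewrite addbF.
move=> /andP[kr uniq_r]; rewrite inE.
have [e|ne_lk] := eqVneq l k; last by rewrite corner_at_swap_neq // IHr.
by subst l; rewrite corner_at_swap IHr // (negPf kr) addbF addbT.
Qed.

Lemma foldr_swap_inj r : injective (foldr swap_at ^~ r).
Proof.
by elim: r => [|k r IHr] pi pi' //= /(can_inj (swap_atK k)) /IHr.
Qed.

Lemma card_corner_at b c :
  #|[set pi : 'S_n | #|[set k | corner_at b pi k]| == c]| =
  #|[set pi : 'S_n | #|[set k | corner_at (~~ b) pi k]| == c]|.
Proof.
(* Swapping once at every index is injective on ['S_n] and toggles all types at once. *)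
rewrite -(card_preimset _ (@foldr_swap_inj (enum 'I_n))).
apply: eq_card => pi; rewrite !inE; congr (_ == c); apply: eq_card => k.
by rewrite !inE corner_at_foldr ?enum_uniq // mem_enum addbT.
Qed.

End Corner.

(** * Occurrences of the two mesh patterns as corners *)

Section Occurrence.
Variables (n : nat) (pi : 'S_n).
Implicit Type f : {ffun 'I_3 -> 'I_n}.

Let o0 : 'I_3 := @Ordinal 3 0 isT.
Let o1 : 'I_3 := @Ordinal 3 1 isT.
Let o2 : 'I_3 := @Ordinal 3 2 isT.

Lemma enum_I3 : enum 'I_3 = [:: o0; o1; o2].
Proof. by apply: (inj_map val_inj); rewrite val_enum_ord. Qed.

Lemma forall_I3 (P : pred 'I_3) : [forall i, P i] = [&& P o0, P o1 & P o2].
Proof.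
apply/forallP/and3P => [all_P|[P0 P1 P2] [[|[|[|//]]] lt_i]]; first by split.
- by rewrite (_ : Ordinal lt_i = o0) //; apply: val_inj.
- by rewrite (_ : Ordinal lt_i = o1) //; apply: val_inj.
- by rewrite (_ : Ordinal lt_i = o2) //; apply: val_inj.
Qed.

Lemma boxesP (k : nat) (s : seq (nat * nat)) (Q : nat -> nat -> 'I_n -> bool) :
  all (fun ab => (ab.1 <= k) && (ab.2 <= k)) s ->
  [forall ab in boxes k s, forall m : 'I_n, Q ab.1 ab.2 m] =
  [forall m : 'I_n, all (fun ab => Q ab.1 ab.2 m) s].
Proof.
move=> /allP le_s; apply/'forall_in_forallP/forallP => [Qs m|Qs ab].
  apply/allP=> -[a b] ab_s; have /= /andP[le_a le_b] := le_s _ ab_s.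
  have := Qs (inord a, inord b); rewrite inE /= !inordK //; exact.
by rewrite inE => ab_s m; have /allP/(_ _ ab_s) := Qs m.
Qed.

(** The square [{0,1,2}^2] together with [(3, 3)]. *)
Definition corner_boxes : seq (nat * nat) :=
  [:: (0, 0); (0, 1); (0, 2); (1, 0); (1, 1); (1, 2);
      (2, 0); (2, 1); (2, 2); (3, 3)].

Lemma gridline_gap (u v w p : nat) (g := gridline n [:: u.+1; v.+1; w.+1]) :
  p < w -> p != u -> p != v -> exists2 k, k < 3 & g k < p.+1 < g k.+1.
Proof.
move=> lt_pw pu pv; have [lt_pu|lt_up|e] := ltngtP p u; last by rewrite e eqxx in pu.
  by exists 0; rewrite // /g /gridline /= !ltnS.
have [lt_pv|lt_vp|e] := ltngtP p v; last by rewrite e eqxx in pv.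
  by exists 1; rewrite // /g /gridline /= !ltnS lt_up.
by exists 2; rewrite // /g /gridline /= !ltnS lt_vp.
Qed.

(** The nine boxes of the square fill the region left of [c] and below [z], apart from the grid
    lines; [(3, 3)] is the quadrant beyond both. A value on the line [z] lies in no box, hence the
    weak [q <= z]. *)
Lemma corner_boxes_avoid a b c x y z p q
    (g := gridline n [:: a.+1; b.+1; c.+1])
    (h := gridline n [:: x.+1; y.+1; z.+1]) :
  a < b < c -> x < y < z -> p < n -> q < n ->
  all (fun ab => ~~ ((g ab.1 < p.+1 < g ab.1.+1) && (h ab.2 < q.+1 < h ab.2.+1)))
      corner_boxes =
  ([&& p < c, p != a, p != b & q \notin [:: x; y; z]] ==> (z < q)) &&
  ((c < p) ==> (q <= z)).
Proof.
move=> abc xyz lt_pn lt_qn; apply/allP/andP.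
  move=> avoid; split; apply/implyP.
    move=> /and4P[lt_pc pa pb]; rewrite !inE !negb_or => /and3P[qx qy qz].
    rewrite ltnNge; apply/negP=> le_qz.
    have [k lt_k in_k] := gridline_gap lt_pc pa pb.
    have [|l lt_l in_l] := @gridline_gap x y z q _ qx qy.
      by rewrite ltn_neqAle qz.
    suff kl : (k, l) \in corner_boxes by have := avoid _ kl; rewrite in_k in_l.
    by move: k l lt_k lt_l {in_k in_l} => [|[|[|//]]] [|[|[|]]].
  move=> lt_cp; rewrite leqNgt; apply/negP=> lt_zq.
  by have := avoid (3, 3) isT; rewrite /g /h /gridline /= !ltnS lt_cp lt_pn lt_zq lt_qn.
rewrite !inE => -[below above] ab; rewrite !inE.
do 9![case/predU1P => [->|]; first by rewrite /g /h /gridline /=; lia].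
by move=> /eqP->; rewrite /g /h /gridline /=; lia.
Qed.

Lemma avoid_corner f (a := f o0) (b := f o1) (c := f o2) :
  a < b < c -> pi a < pi b -> pi a < pi c ->
  [forall ab in boxes 3 corner_boxes, forall m : 'I_n,
     ~~ in_box pi f ab.1 ab.2 m] = corner pi a b c.
Proof.
move=> abc lt_ab lt_ac; rewrite (boxesP (fun a b m => ~~ in_box pi f a b m)) //.
have neq_val (m m' : 'I_n) : m != m' -> nat_of_ord (pi m) != nat_of_ord (pi m').
  by rewrite (inj_eq val_inj) (inj_eq perm_inj).
have ne_bc : nat_of_ord (pi b) != pi c by apply: neq_val; rewrite -val_eqE ltn_eqF //; case/andP: abc.
(* [y] and [z] are the smaller and the larger of [pi b] and [pi c], which treats both patterns
   together. *)
have [y [z [xyz sort_val yz max_z]]] : exists y z, [/\ pi a < y < z,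
    occ_val pi f = [:: (pi a).+1; y.+1; z.+1],
    (y, z) = (nat_of_ord (pi b), nat_of_ord (pi c)) \/
    (y, z) = (nat_of_ord (pi c), nat_of_ord (pi b)) & z = maxn (pi b) (pi c)].
  rewrite /occ_val enum_I3 /= -/a -/b -/c.
  have [lt_bc|lt_cb|e] := ltngtP (pi b) (pi c); last by rewrite e eqxx in ne_bc.
    exists (pi b), (pi c); split; [by rewrite lt_ab| |by left|by []].
    by apply: (sorted_sort leq_trans); rewrite /= !ltnS (ltnW lt_ab) (ltnW lt_bc).
  exists (pi c), (pi b); split; [by rewrite lt_ac| |by right|by []].
  rewrite (_ : sort _ _ = sort leq [:: (pi a).+1; (pi c).+1; (pi b).+1]).
    by apply: (sorted_sort leq_trans); rewrite /= !ltnS (ltnW lt_ac) (ltnW lt_cb).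
  apply/perm_sortP; [exact: leq_total|exact: leq_trans|exact: anti_leq|].
  by rewrite perm_cons (perm_catC [:: _] [:: _]).
have boxE m : all (fun ab => ~~ in_box pi f ab.1 ab.2 m) corner_boxes =
    ([&& m < c, m != a & m != b] ==> (pi b < pi m) && (pi c < pi m)) &&
    ((c < m) ==> (pi m < pi b) || (pi m < pi c)).
  rewrite /in_box sort_val /occ_pos enum_I3 /= -/a -/b -/c.
  have /= -> := corner_boxes_avoid abc xyz (ltn_ord m) (ltn_ord (pi m)).
  (* By injectivity, a point left of [c] other than [a] and [b] is on no horizontal grid line. *)
  have -> : [&& m < c, m != a :> nat, m != b :> nat
              & (pi m : nat) \notin [:: pi a : nat; y; z]]
          = [&& m < c, m != a & m != b].
    rewrite !val_eqE; have [lt_mc|//] := ltnP m c; have [//|ma] := eqVneq m a.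
    have [//|mb] := eqVneq m b; rewrite !inE /=.
    have mc : m != c by rewrite -val_eqE ltn_eqF.
    move: (neq_val _ _ ma) (neq_val _ _ mb) (neq_val _ _ mc).
    by case: yz => -[-> ->] /negPf-> /negPf-> /negPf->.
  rewrite max_z gtn_max; congr (_ && _).
  have [lt_cm|//] := ltnP c m; rewrite /= leq_max.
  (* Injectivity again makes the weak bound by the maximum strict. *)
  have /neq_val mb : m != b.
    by rewrite -val_eqE gtn_eqF //; case/andP: abc => _ /ltn_trans; apply.
  have /neq_val mc : m != c by rewrite -val_eqE gtn_eqF.
  by rewrite !(ltn_neqAle (pi m)) mb mc.
rewrite (eq_forallb boxE) /corner abc lt_ab lt_ac /=.
apply/forallP/andP => [avoid|[/forallP below /forallP above] m].
  by split; apply/forallP=> m; have /andP[] := avoid m.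
by rewrite below above.
Qed.

Lemma occurrence123 f :
  occurrence (MeshPattern perm123 (boxes 3 corner_boxes)) pi f =
  corner pi (f o0) (f o1) (f o2) && ((pi (f o1) < pi (f o2)) == true).
Proof.
rewrite /occurrence /= !forall_I3 /= !perm1 /= !ltnn.
apply/and3P/andP => [[incr iso avoid]|[cor lt_bc]].
  by rewrite avoid_corner in avoid; [split=> //|..]; move: incr iso; lia.
have /cornerP[abc lt_ab lt_ac _ _] := cor.
by split; [lia|lia|rewrite avoid_corner].
Qed.

Lemma occurrence132 f :
  occurrence (MeshPattern perm132 (boxes 3 corner_boxes)) pi f =
  corner pi (f o0) (f o1) (f o2) && ((pi (f o1) < pi (f o2)) == false).
Proof.
have -> : perm132 = tperm o1 o2.
  by congr tperm; apply: val_inj; rewrite /= inordK.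
rewrite /occurrence /= !forall_I3 /= tpermL tpermR tpermD //= !ltnn.
apply/and3P/andP => [[incr iso avoid]|[cor lt_bc]].
  by rewrite avoid_corner in avoid; [split=> //|..]; move: incr iso; lia.
have /cornerP[abc lt_ab lt_ac _ _] := cor; have ne_bc := corner_neq cor.
by split; [lia|lia|rewrite avoid_corner].
Qed.

(** By [corner_uniq], an occurrence is determined by its last index [f o2]. *)
Lemma nb_occ_corner_at (p : mesh_pattern 3) b :
  (forall f, occurrence p pi f =
     corner pi (f o0) (f o1) (f o2) && ((pi (f o1) < pi (f o2)) == b)) ->
  nb_occ p pi = #|[set k | corner_at b pi k]|.
Proof.
move=> occE; rewrite /nb_occ -(card_in_imset (f := fun f => f o2)) => [|f f'].
  apply: eq_card => k; rewrite inE; apply/imsetP/corner_atP.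
    move=> [f]; rewrite inE occE => /andP[cor /eqP lt_b] ->.
    by exists (f o0), (f o1).
  (* The default [k] of [nth] supplies the third index. *)
  move=> [i [j [cor lt_b]]]; exists [ffun m : 'I_3 => nth k [:: i; j] m].
    by rewrite inE occE !ffunE /= cor lt_b eqxx.
  by rewrite ffunE.
rewrite !inE !occE => /andP[cor _] /andP[cor' _] e2; rewrite -e2 in cor'.
have [e0 e1] := corner_uniq cor cor'.
apply/ffunP=> m; apply/eqP; move: m; apply/forallP.
by rewrite forall_I3 e0 e1 e2 !eqxx.
Qed.

End Occurrence.

Theorem theorem3p4 :
  let R := boxes 3 [:: (0, 0); (0, 1); (0, 2); (1, 0); (1, 1); (1, 2);
                       (2, 0); (2, 1); (2, 2); (3, 3)] in
  equidistributed (MeshPattern perm123 R) (MeshPattern perm132 R).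
Proof.
move=> R n l.
transitivity #|[set pi : 'S_n | #|[set k | corner_at true pi k]| == l]|.
  by apply: eq_card => pi; rewrite !inE (nb_occ_corner_at (occurrence123 pi)).
rewrite card_corner_at.
by apply: eq_card => pi; rewrite !inE (nb_occ_corner_at (occurrence132 pi)).
Qed.
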